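(* Let $\mathbb{G}$ be a discrete quantum group, let $\omega\in M^u(\widehat{\mathbb{G}})$ be an idempotent state, and let $N_\omega$ be the corresponding compact quasi-subgroup of $\widehat{\mathbb{G}}$. Then $N_\omega$ is coamenable if and only if $\omega\in M^r(\widehat{\mathbb{G}})=C_r(\widehat{\mathbb{G}})^*$ (i.e. $\omega$ factors through the canonical surjection $\Gamma_{\widehat{\mathbb{G}}}:C_u(\widehat{\mathbb{G}})\to C_r(\widehat{\mathbb{G}})$).
   Context: $\widehat{\mathbb{G}}$ is the compact quantum group dual to the discrete quantum group $\mathbb{G}$, with von Neumann algebra $L^\infty(\widehat{\mathbb{G}})$, coproduct $\Delta_{\widehat{\mathbb{G}}}$ and predual $L^1(\widehat{\mathbb{G}})$. $\mathrm{Irr}(\widehat{\mathbb{G}})$ is a set of representatives of the irreducible unitary representations $U^\pi=[u^\pi_{i,j}]\in L^\infty(\widehat{\mathbb{G}})\overline{\otimes}B(\mathcal{H}_\pi)$, $n_\pi=\dim\mathcal{H}_\pi<\infty$, with $\Delta_{\widehat{\mathbb{G}}}(u^\pi_{i,j})=\sum_t u^\pi_{i,t}\otimes u^\pi_{t,j}$, and $\mathrm{Pol}(\widehat{\mathbb{G}})$ is the linear span of the $u^\pi_{i,j}$. $C_u(\widehat{\mathbb{G}})$ and $C_r(\widehat{\mathbb{G}})\subseteq L^\infty(\widehat{\mathbb{G}})$ are the universal and reduced $C^*$-completions of $\mathrm{Pol}(\widehat{\mathbb{G}})$, $\Gamma_{\widehat{\mathbb{G}}}:C_u(\widehat{\mathbb{G}})\to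 C_r(\widehat{\mathbb{G}})$ is the canonical surjection, and $\epsilon^u_{\widehat{\mathbb{G}}}:C_u(\widehat{\mathbb{G}})\to\mathbb{C}$ is the counit, $\epsilon^u_{\widehat{\mathbb{G}}}(u^\pi_{i,j})=\delta_{i,j}$. $M^u(\widehat{\mathbb{G}})=C_u(\widehat{\mathbb{G}})^*$ and $M^r(\widehat{\mathbb{G}})=C_r(\widehat{\mathbb{G}})^*$ carry the convolution product $\mu*\nu=(\mu\otimes\nu)\circ\Delta$; $M^r(\widehat{\mathbb{G}})$ is regarded as a subset of $M^u(\widehat{\mathbb{G}})$ via $\mu\mapsto\mu\circ\Gamma_{\widehat{\mathbb{G}}}$, and $L^1(\widehat{\mathbb{G}})\subseteq M^r(\widehat{\mathbb{G}})$ is a closed ideal of $M^u(\widehat{\mathbb{G}})$. An idempotent state is a state $\omega$ on $C_u(\widehat{\mathbb{G}})$ with $\omega*\omega=\omega$. $R_\omega:L^\infty(\widehat{\mathbb{G}})\to L^\infty(\widehat{\mathbb{G}})$ is the adjoint of $\nu\mapsto\nu*\omega$ on $L^1(\widehat{\mathbb{G}})$ (so $R_\omega=(\mathrm{id}\otimes\omega)\Delta_{\widehat{\mathbb{G}}}$ on $\mathrm{Pol}(\widehat{\mathbb{G}})$). The compact quasi-subgroup associated with $\omega$ is the right coideal $N_\omega=R_\omega(L^\infty(\widehat{\mathbb{G}}))$. Put $\mathrm{Pol}(\widehat{E}_\omega)=R_\omega(\mathrm{Pol}(\widehat{\mathbb{G}}))$, $C_u(\widehat{E}_\omega)=\overline{\mathrm{Pol}(\widehat{E}_\omega)}^{\|\cdot\|_u}\subseteq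 C_u(\widehat{\mathbb{G}})$ and $C_r(\widehat{E}_\omega)=\Gamma_{\widehat{\mathbb{G}}}(C_u(\widehat{E}_\omega))$. $N_\omega$ is called coamenable if there is a state $\epsilon_N\in C_r(\widehat{E}_\omega)^*$ with $\epsilon_N\circ\Gamma_{\widehat{\mathbb{G}}}|_{C_u(\widehat{E}_\omega)}=\epsilon^u_{\widehat{\mathbb{G}}}|_{C_u(\widehat{E}_\omega)}$. *)

(* Defs.v *)
From HB Require Import structures.
From mathcomp Require Import all_boot all_order all_algebra.
From mathcomp Require Import sesquilinear spectral complex.
From mathcomp Require Import all_classical all_reals all_analysis.
Import numFieldNormedType.Exports.
Import Order.TTheory GRing.Theory Num.Theory.

Set Implicit Arguments.
Unset Strict Implicit.
Unset Printing Implicit Defensive.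

Local Open Scope ring_scope.
Local Open Scope sesquilinear_scope.
Local Open Scope classical_set_scope.

Definition lin_span (K : numFieldType) (V : lmodType K) (S : set V) : set V :=
  [set x | exists (n : nat) (c : 'I_n -> K) (v : 'I_n -> V),
     (forall i, S (v i)) /\ x = \sum_(i < n) c i *: v i].

(* The inner product is linear in its first argument. *)
Record hilbertSpace (R : realType) := HilbertSpace {
  hs_space :> completeNormedModType R[i];
  dotp : {dot hs_space for Num.conj};
  dotp_norm : forall x, `|x| ^+ 2 = dotp x x }.

Notation op H := (H -> H).

(* Operators are bare functions (with the pointwise lmodType structure and
   composition as product); boundedness is the following predicate. *)
Definition bounded_op (R : realType) (H : hilbertSpace R) (T : op H) : Prop :=
  linear T /\ exists c : R[i], forall x, `|T x| <= c * `|x|.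

Definition adjoint (R : realType) (H : hilbertSpace R) (T S : op H) : Prop :=
  forall x y, dotp H (T x) y = dotp H x (S y).

Definition commutant (R : realType) (H : hilbertSpace R) (A : set (op H)) :
    set (op H) :=
  [set T | bounded_op T /\ forall S, A S -> T \o S = S \o T].

Definition von_neumann (R : realType) (H : hilbertSpace R) (M : set (op H)) :
    Prop :=
  (forall T, M T -> exists S, M S /\ adjoint T S) /\
  commutant (commutant M) = M.

Definition star_subalgebra (R : realType) (H : hilbertSpace R)
    (P : set (op H)) : Prop :=
  [/\ P `<=` @bounded_op R H,
      P idfun,
      forall (a : R[i]) T S, P T -> P S -> P (a *: T + S),
      forall T S, P T -> P S -> P (T \o S) &
      forall T, P T -> exists S, P S /\ adjoint T S].

(* Elements of the predual of [M]: the ultraweakly continuous functionals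
   T |-> \sum_k <T xi_k, eta_k>, with xi and eta square-summable.  A functional
   on [M] is represented by any function agreeing with it on [M]. *)
Definition normal_functional (R : realType) (H : hilbertSpace R)
    (M : set (op H)) (f : op H -> R[i]) : Prop :=
  exists xi eta : nat -> H,
    [/\ exists c : R[i], forall n, \sum_(k < n) `|xi k| ^+ 2 <= c,
        exists c : R[i], forall n, \sum_(k < n) `|eta k| ^+ 2 <= c &
        forall T, M T ->
          series (fun k => dotp H (T (xi k)) (eta k) : R[i]^o) @ \oo
            --> (f T : R[i]^o)].

(* The Hilbert space tensor product H (x) H, which is determined up to unitary
   isomorphism by the following data. *)
Record tensorSquare (R : realType) (H : hilbertSpace R) := TensorSquare {
  ts_space :> hilbertSpace R;
  tens : H -> H -> ts_space;
  tens_dot : forall x y x' y',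
    dotp ts_space (tens x y) (tens x' y') = dotp H x x' * dotp H y y';
  tens_total :
    closure (lin_span [set z | exists x y, z = tens x y]) = [set: ts_space] }.

(* The von Neumann algebra tensor product of M with itself. *)
Definition vN_tensor (R : realType) (H : hilbertSpace R)
    (HH : tensorSquare H) (M : set (op H)) : set (op HH) :=
  commutant (commutant [set X | bounded_op X /\ exists T S, [/\ M T, M S &
    forall x y, X (tens HH x y) = tens HH (T x) (S y)]]).

Arguments vN_tensor {R H} HH M.

(* A compact quantum group in the von Neumann algebraic setting, represented
   on the GNS space of its Haar state h(T) = <T haar, haar>.  Identities between
   operators on H (x) H (x) H and invariance of h are tested on vector
   functionals, so that only slices of [cop T] occur. *)
Record compactQG (R : realType) := CompactQG {
  L2 : hilbertSpace R;
  L2L2 : tensorSquare L2;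
  Linf : set (op L2);
  Linf_vN : von_neumann Linf;
  cop : op L2 -> op L2L2;
  cop_Linf : forall T, Linf T -> vN_tensor L2L2 Linf (cop T);
  cop1 : cop idfun = idfun;
  cop_linear : forall (a : R[i]) T S, Linf T -> Linf S ->
    cop (a *: T + S) = a *: cop T + cop S;
  copM : forall T S, Linf T -> Linf S -> cop (T \o S) = cop T \o cop S;
  cop_adj : forall T S, Linf T -> Linf S -> adjoint T S ->
    adjoint (cop T) (cop S);
  cop_normal : forall f, normal_functional (vN_tensor L2L2 Linf) f ->
    normal_functional Linf (f \o cop);
  (* With S = (id (x) w3) cop T and S' = (w1 (x) id) cop T, where wk is the
     vector functional of (xk, yk), both sides are
     (w1 (x) w2 (x) w3) of (cop (x) id) cop T = (id (x) cop) cop T. *)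
  cop_coassoc : forall (T S S' : op L2) (x1 x2 x3 y1 y2 y3 : L2),
    Linf T -> Linf S -> Linf S' ->
    (forall x y, dotp L2L2 (cop T (tens L2L2 x x3)) (tens L2L2 y y3)
               = dotp L2 (S x) y) ->
    (forall x y, dotp L2L2 (cop T (tens L2L2 x1 x)) (tens L2L2 y1 y)
               = dotp L2 (S' x) y) ->
    dotp L2L2 (cop S (tens L2L2 x1 x2)) (tens L2L2 y1 y2) =
    dotp L2L2 (cop S' (tens L2L2 x2 x3)) (tens L2L2 y2 y3);
  haar : L2;
  haar_norm : `|haar| = 1;
  haar_cyclic :
    closure [set x | exists T, Linf T /\ x = T haar] = [set: L2];
  haar_faithful : forall T, Linf T -> T haar = 0 -> T = 0;
  haar_invl : forall T x y, Linf T ->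
    dotp L2L2 (cop T (tens L2L2 haar x)) (tens L2L2 haar y) =
    dotp L2 (T haar) haar * dotp L2 x y;
  haar_invr : forall T x y, Linf T ->
    dotp L2L2 (cop T (tens L2L2 x haar)) (tens L2L2 y haar) =
    dotp L2 (T haar) haar * dotp L2 x y }.

Arguments Linf {R} c.
Arguments haar {R} c.

Definition unitary_rep (R : realType) (G : compactQG R) (n : nat)
    (u : 'I_n -> 'I_n -> op (L2 G)) : Prop :=
  [/\ forall i j, Linf G (u i j),
      exists v : 'I_n -> 'I_n -> op (L2 G),
        [/\ forall i j, adjoint (u i j) (v i j),
            forall i j, \sum_k (v k i \o u k j) = (i == j)%:R *: idfun &
            forall i j, \sum_k (u i k \o v j k) = (i == j)%:R *: idfun] &
      forall i j x y, cop (u i j) (tens (L2L2 G) x y) =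
        \sum_t tens (L2L2 G) (u i t x) (u t j y)].

(* U X = X V *)
Definition intertwiner (R : realType) (G : compactQG R) (n m : nat)
    (u : 'I_n -> 'I_n -> op (L2 G)) (v : 'I_m -> 'I_m -> op (L2 G))
    (X : 'M[R[i]]_(n, m)) : Prop :=
  forall i j, \sum_k X k j *: u i k = \sum_k X i k *: v k j.

Definition irreducible_rep (R : realType) (G : compactQG R) (n : nat)
    (u : 'I_n -> 'I_n -> op (L2 G)) : Prop :=
  (0 < n)%N /\ forall X : 'M[R[i]]_n, intertwiner u u X -> is_scalar_mx X.

Definition equivalent_rep (R : realType) (G : compactQG R) (n m : nat)
    (u : 'I_n -> 'I_n -> op (L2 G)) (v : 'I_m -> 'I_m -> op (L2 G)) : Prop :=
  exists X : 'M[R[i]]_(n, m),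
    [/\ intertwiner u v X, X \is unitarymx & X ^t* \is unitarymx].

Definition coef_span (R : realType) (H : hilbertSpace R) (I : Type)
    (n : I -> nat) (u : forall p, 'I_(n p) -> 'I_(n p) -> op H) : set (op H) :=
  lin_span [set T : op H | exists p i j, T = u p i j].

(* A set of representatives of the irreducible unitary representations.  The
   last three fields are the Peter-Weyl theorem, valid for every compact
   quantum group: the coefficients span a *-algebra, which is dense in L^2 and
   generates the von Neumann algebra L^oo. *)
Record irrSystem (R : realType) (G : compactQG R) := IrrSystem {
  Irr : Type;
  irr_dim : Irr -> nat;
  irr_u : forall p, 'I_(irr_dim p) -> 'I_(irr_dim p) -> op (L2 G);
  irr_unitary : forall p, unitary_rep (@irr_u p);
  irr_irreducible : forall p, irreducible_rep (@irr_u p);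
  irr_inequivalent : forall p q, equivalent_rep (@irr_u p) (@irr_u q) -> p = q;
  irr_exhaustive : forall (n : nat) (u : 'I_n -> 'I_n -> op (L2 G)),
    unitary_rep u -> irreducible_rep u ->
    exists p, equivalent_rep (@irr_u p) u;
  irr_star_subalgebra : star_subalgebra (coef_span irr_u);
  irr_dense_L2 :
    closure [set x | exists T, coef_span irr_u T /\ x = T (haar G)]
      = [set: L2 G];
  irr_dense_Linf : commutant (commutant (coef_span irr_u)) = Linf G }.

Arguments irr_u {R G i} p _ _.

Definition Pol (R : realType) (G : compactQG R) (I : irrSystem G) :
    set (op (L2 G)) := coef_span (@irr_u R G I).

Record cstarAlgebra (R : realType) := CstarAlgebra {
  cs_space :> completeNormedModType R[i];
  cmul : cs_space -> cs_space -> cs_space;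
  cone : cs_space;
  cstar : cs_space -> cs_space;
  cmulA : associative cmul;
  cmul1x : left_id cone cmul;
  cmulx1 : right_id cone cmul;
  cmul_linearl : forall (a : R[i]) x y z,
    cmul (a *: x + y) z = a *: cmul x z + cmul y z;
  cmul_linearr : forall (a : R[i]) x y z,
    cmul z (a *: x + y) = a *: cmul z x + cmul z y;
  cstar_linear : forall (a : R[i]) x y,
    cstar (a *: x + y) = Num.conj a *: cstar x + cstar y;
  cstarK : involutive cstar;
  cstarM : forall x y, cstar (cmul x y) = cmul (cstar y) (cstar x);
  cmul_norm : forall x y, `|cmul x y| <= `|x| * `|y|;
  cstar_norm : forall x, `|cmul (cstar x) x| = `|x| ^+ 2 }.

(* Unital *-homomorphisms; the last clause is automatic. *)
Definition star_hom (R : realType) (A B : cstarAlgebra R) (f : A -> B) : Prop :=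
  [/\ linear f,
      forall x y, f (cmul x y) = cmul (f x) (f y),
      f (cone A) = cone B,
      forall x, f (cstar x) = cstar (f x) &
      forall x, `|f x| <= `|x|].

Definition character (R : realType) (A : cstarAlgebra R) (f : A -> R[i]) :
    Prop :=
  [/\ scalar f,
      forall x y, f (cmul x y) = f x * f y,
      f (cone A) = 1,
      forall x, f (cstar x) = Num.conj (f x) &
      forall x, `|f x| <= `|x|].

(* Unital *-homomorphisms from a *-algebra [P] of operators (represented by
   functions whose values outside [P] are irrelevant) to a C*-algebra. *)
Definition star_hom_on (R : realType) (H : hilbertSpace R) (P : set (op H))
    (B : cstarAlgebra R) (f : op H -> B) : Prop :=
  [/\ forall (a : R[i]) T S, P T -> P S -> f (a *: T + S) = a *: f T + f S,
      forall T S, P T -> P S -> f (T \o S) = cmul (f T) (f S),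
      f idfun = cone B &
      forall T S, P T -> P S -> adjoint T S -> f S = cstar (f T)].

Record completion (R : realType) (H : hilbertSpace R) (P : set (op H)) :=
  Completion {
  co_alg :> cstarAlgebra R;
  co_in : op H -> co_alg;
  co_in_hom : star_hom_on P co_in;
  co_dense : closure (co_in @` P) = [set: co_alg] }.

Definition universal_completion (R : realType) (H : hilbertSpace R)
    (P : set (op H)) (A : completion P) : Prop :=
  forall (B : cstarAlgebra R) (f : op H -> B), star_hom_on P f ->
  exists g : A -> B, star_hom g /\ forall T, P T -> g (co_in A T) = f T.

(* The completion for the operator norm, i.e. the norm closure of [P] in the
   bounded operators: `|co_in A T| is the least bound of T. *)
Definition reduced_completion (R : realType) (H : hilbertSpace R)
    (P : set (op H)) (A : completion P) : Prop :=
  forall T, P T ->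
    (forall x, `|T x| <= `|co_in A T| * `|x|) /\
    (forall c : R[i], 0 <= c -> (forall x, `|T x| <= c * `|x|) ->
       `|co_in A T| <= c).

(* The *-homomorphism C_u -> C_r extending the identity of Pol; it is unique
   because Pol is dense, and onto because its range is closed. *)
Definition canonical_surjection (R : realType) (G : compactQG R)
    (I : irrSystem G) (Cu Cr : completion (Pol I)) (Gam : Cu -> Cr) : Prop :=
  star_hom Gam /\ forall T, Pol I T -> Gam (co_in Cu T) = co_in Cr T.

Definition is_counit (R : realType) (G : compactQG R) (I : irrSystem G)
    (Cu : completion (Pol I)) (eps : Cu -> R[i]) : Prop :=
  character eps /\
  forall (p : Irr I) i j, eps (co_in Cu (irr_u p i j)) = (i == j)%:R.

(* Bounded functionals on a subspace [S] of a C*-algebra, represented by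
   functions whose values outside [S] are irrelevant. *)
Definition dual_on (R : realType) (A : cstarAlgebra R) (S : set A)
    (f : A -> R[i]) : Prop :=
  (forall (a : R[i]) x y, S x -> S y -> f (a *: x + y) = a * f x + f y) /\
  exists c : R[i], forall x, S x -> `|f x| <= c * `|x|.

Definition state_on (R : realType) (A : cstarAlgebra R) (S : set A)
    (f : A -> R[i]) : Prop :=
  [/\ dual_on S f, f (cone A) = 1 &
      forall x, S (cmul (cstar x) x) -> 0 <= f (cmul (cstar x) x)].

(* lam = mu * nu = (mu (x) nu) \o cop.  A bounded functional on C_u or a normal
   functional on L^oo is determined by its restriction to Pol, where the
   coproduct is cop u_ij = \sum_t u_it (x) u_tj. *)
Definition is_convolution (R : realType) (G : compactQG R) (I : irrSystem G)
    (mu nu lam : op (L2 G) -> R[i]) : Prop :=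
  forall (p : Irr I) i j,
    lam (irr_u p i j) =
    \sum_(t < irr_dim p) mu (irr_u p i t) * nu (irr_u p t j).

Definition idempotent_state (R : realType) (G : compactQG R) (I : irrSystem G)
    (Cu : completion (Pol I)) (om : Cu -> R[i]) : Prop :=
  state_on [set: Cu] om /\
  is_convolution I (om \o co_in Cu) (om \o co_in Cu) (om \o co_in Cu).

(* M^r inside M^u, through mu |-> mu \o Gam. *)
Definition Mr (R : realType) (G : compactQG R) (I : irrSystem G)
    (Cu Cr : completion (Pol I)) (Gam : Cu -> Cr) : set (Cu -> R[i]) :=
  [set om | exists mu : Cr -> R[i],
     dual_on [set: Cr] mu /\ forall x, om x = mu (Gam x)].

(* T = R_om S, where R_om is the adjoint of nu |-> nu * om on the predual L^1:
   <nu, R_om S> = <nu * om, S> for all nu in L^1. *)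
Definition R_graph (R : realType) (G : compactQG R) (I : irrSystem G)
    (Cu : completion (Pol I)) (om : Cu -> R[i]) (S T : op (L2 G)) : Prop :=
  [/\ Linf G S, Linf G T &
      forall nu nu' : op (L2 G) -> R[i],
        normal_functional (Linf G) nu -> normal_functional (Linf G) nu' ->
        is_convolution I nu (om \o co_in Cu) nu' -> nu T = nu' S].

(* The compact quasi-subgroup N_om. *)
Definition quasi_subgroup (R : realType) (G : compactQG R) (I : irrSystem G)
    (Cu : completion (Pol I)) (om : Cu -> R[i]) : set (op (L2 G)) :=
  [set T | exists S, Linf G S /\ R_graph om S T].

Definition PolE (R : realType) (G : compactQG R) (I : irrSystem G)
    (Cu : completion (Pol I)) (om : Cu -> R[i]) : set (op (L2 G)) :=
  [set T | exists S, Pol I S /\ R_graph om S T].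

Definition CuE (R : realType) (G : compactQG R) (I : irrSystem G)
    (Cu : completion (Pol I)) (om : Cu -> R[i]) : set Cu :=
  closure (co_in Cu @` PolE om).

Definition CrE (R : realType) (G : compactQG R) (I : irrSystem G)
    (Cu Cr : completion (Pol I)) (Gam : Cu -> Cr) (om : Cu -> R[i]) : set Cr :=
  Gam @` CuE om.

(* Coamenability of N_om; it depends on N_om only through R_om, by way of
   Pol(E_om) = R_om(Pol). *)
Definition coamenable (R : realType) (G : compactQG R) (I : irrSystem G)
    (Cu Cr : completion (Pol I)) (Gam : Cu -> Cr) (eps : Cu -> R[i])
    (om : Cu -> R[i]) : Prop :=
  exists epsN : Cr -> R[i], state_on (CrE Gam om) epsN /\
    forall x, CuE om x -> epsN (Gam x) = eps x.

(* Main.v *)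
Require Import Defs.
From HB Require Import structures.
From mathcomp Require Import all_boot all_order all_algebra.
From mathcomp Require Import sesquilinear spectral complex.
From mathcomp Require Import ring.
From mathcomp Require Import all_classical all_reals all_analysis.
Import numFieldNormedType.Exports.
Import Order.TTheory GRing.Theory Num.Theory.

(** Write R = (id (x) om) o cop for the convolution operator of the idempotent
state om, acting on Pol.  The counit gives eps o R = om on Pol, and idempotency
gives om o R = om.  Hence eps and om agree on Pol(E_om) = R(Pol), and by
continuity on C_u(E_om) ([eps_om_CuE]).

If om = mu o Gam, then mu itself restricts to the required state on C_r(E_om);
it is positive on all of C_r because the image of Pol is dense there
([Mr_coamenable]).

Conversely, let epsN be a bounded functional on C_r(E_om) through which eps
factors.  Then om(S) = eps(R S) = epsN(Gam (R S)) for S in Pol, so om is bounded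
for the reduced norm, and extends to C_r, as soon as R is ([coamenable_Mr]).

The substance is therefore that R is a contraction for the operator norm on
L^2.  This is a form of Fell absorption, kept on Pol.  Equip Pol (x) Pol with
the form <x (x) y, x' (x) y'> = h(x'^* x) om(y'^* y).  By invariance of h the map
x (x) y |-> cop(x)(1 (x) y) is isometric, it intertwines S (x) 1 with cop(S), and
the antipode makes it onto: for a in Pol there is a tensor zeta_a which it sends
to a (x) 1 ([untwist_exists]).  Therefore
   <R(S) a h, b h> = <(S (x) 1) zeta_a, zeta_b>      ([matrix_coef_twist]),
where h also denotes the vector that implements the Haar state.  The form is
positive by the Schur product theorem ([pos_kernel_sum]), and so S (x) 1 is
bounded on it by the norm of S ([om_convolved_bound]).

The same formula links the predual definition of R_om to the algebraic R.  Its
right-hand side is a finite sum of vector functionals of S; thus nu * om is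
normal for every vector functional nu with vectors in Pol h, and there are enough
of these to determine an operator ([R_graph_unique]). *)

Set Implicit Arguments.
Unset Strict Implicit.
Unset Printing Implicit Defensive.
Local Open Scope ring_scope.
Local Open Scope sesquilinear_scope.
Local Open Scope classical_set_scope.

(** * Positive kernels and the Schur product theorem *)

Definition pos_kernel (C : numClosedFieldType) (T : Type) (K : T -> T -> C) :
    Prop :=
  (forall x y, K x y = Num.conj (K y x)) /\
  forall n (x : 'I_n -> T) (c : 'I_n -> C),
    0 <= \sum_i \sum_j c i * Num.conj (c j) * K (x i) (x j).

(** The spectral theorem writes the Gram matrix as U^* D U with D >= 0; W is the
square root of D times the conjugate of U. *)
Lemma pos_kernel_gram (C : numClosedFieldType) (T : Type) (K : T -> T -> C)
    (n : nat) (x : 'I_n -> T) : pos_kernel K ->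
  exists W : 'I_n -> 'I_n -> C,
    forall i j, K (x i) (x j) = \sum_k W k i * Num.conj (W k j).
Proof.
case=> Kherm Kpos; pose A : 'M[C]_n := \matrix_(i, j) K (x i) (x j).
have Aherm : A \is hermsymmx.
  apply/is_hermitianmxP; rewrite expr0 scale1r.
  by apply/matrixP => i j; rewrite !mxE Kherm.
have /orthomx_spectralP := hermitian_normalmx Aherm.
have Uu := spectral_unitarymx A.
set P := spectralmx A in Uu *; set d := spectral_diag A => AE.
rewrite (invmx_unitary Uu) in AE.
have dE : P *m A *m P ^t* = diag_mx d.
  rewrite {1}AE !mulmxA (unitarymxP Uu) mul1mx -mulmxA.
  by rewrite (unitarymxP Uu) mulmx1.
have dpos k : 0 <= d 0 k.
  have := Kpos n x (P k); congr (0 <= _).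
  have /matrixP /(_ k k) := dE; rewrite [in RHS]mxE eqxx mulr1n => <-.
  rewrite mxE exchange_big /=; apply: eq_bigr => j _.
  rewrite mxE mulr_suml !mxE; apply: eq_bigr => i _.
  by rewrite !mxE mulrAC.
exists (fun k i => sqrtC (d 0 k) * Num.conj (P k i)) => i j.
have /matrixP /(_ i j) := AE; rewrite [in LHS]mxE => ->.
rewrite mxE; apply: eq_bigr => k _.
rewrite mul_mx_diag !mxE.
have -> (a b : C) : Num.conj (a * Num.conj b) = Num.conj a * b.
  by rewrite rmorphM /= conjCK.
rewrite (geC0_conj (x := sqrtC _)) ?sqrtC_ge0 ?dpos // mulrACA -expr2 sqrtCK.
by rewrite mulrCA mulrA.
Qed.

(** Schur product theorem: a Gram factorization of L turns the sum into a sum of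
values of the quadratic form of K. *)
Lemma pos_kernel_sum (C : numClosedFieldType) (T : Type) (K L : T -> T -> C)
    (s : seq T) : pos_kernel K -> pos_kernel L ->
  0 <= \sum_(z <- s) \sum_(w <- s) K z w * L z w.
Proof.
move=> posK posL; pose x := tnth (in_tuple s).
have [W WE] := pos_kernel_gram x posL.
have -> : \sum_(z <- s) \sum_(w <- s) K z w * L z w =
    \sum_k \sum_i \sum_j W k i * Num.conj (W k j) * K (x i) (x j).
  rewrite [RHS]exchange_big /= big_tnth; apply: eq_bigr => i _.
  rewrite [RHS]exchange_big /= big_tnth; apply: eq_bigr => j _.
  by rewrite WE mulr_sumr; apply: eq_bigr => k _; rewrite mulrC.
by apply: sumr_ge0 => k _; apply: posK.2.
Qed.

Lemma pos_kernel_comp (C : numClosedFieldType) (T U : Type) (K : T -> T -> C)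
    (f : U -> T) : pos_kernel K -> pos_kernel (fun x y => K (f x) (f y)).
Proof. by case=> Kh Kp; split=> [x y|n x c]; [exact: Kh|exact: Kp]. Qed.

(** * Linear maps and spans *)

Lemma lin_span_ind (K : numFieldType) (V : lmodType K) (S Q : set V) :
  Q 0 -> (forall c v w, S v -> Q w -> Q (c *: v + w)) -> lin_span S `<=` Q.
Proof.
move=> Q0 Qlin _ [n [c [v [Sv ->]]]].
by elim/big_rec: _ => // i x _ Qx; apply: Qlin.
Qed.

Section LinearMaps.
Variables (K : numFieldType) (V W : lmodType K) (f : V -> W).
Hypothesis flin : linear f.

Lemma lin0 : f 0 = 0.
Proof. by have := flin (-1) 0 0; rewrite scaler0 addr0 scaleN1r addNr. Qed.
Lemma linD x y : f (x + y) = f x + f y.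
Proof. by have := flin 1 x y; rewrite !scale1r. Qed.
Lemma linZ a x : f (a *: x) = a *: f x.
Proof. by have := flin a x 0; rewrite lin0 !addr0. Qed.
Lemma lin_sum (J : Type) (r : seq J) (g : J -> V) :
  f (\sum_(i <- r) g i) = \sum_(i <- r) f (g i).
Proof. by elim/big_rec2: _ => [|i x y _ <-]; rewrite ?lin0 ?linD. Qed.
End LinearMaps.

Lemma sum_trunc (K : nmodType) (g : nat -> K) (N n : nat) :
  (forall k, (N <= k)%N -> g k = 0) -> (N <= n)%N ->
  \sum_(k < n) g k = \sum_(k < N) g k.
Proof.
move=> g0 Nn; rewrite -!(big_mkord xpredT g) (big_cat_nat _ (n := N)) //=.
rewrite [X in _ + X]big_nat_cond [X in _ + X]big1 ?addr0 // => k.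
by rewrite andbT => /andP[/g0].
Qed.

(** * Hilbert spaces and density *)

Lemma closure_approx (K : numFieldType) (V : normedModType K) (A : set V) x :
  closure A x -> forall e, 0 < e -> exists2 y, A y & `|x - y| < e.
Proof.
move=> Ax e e0; have [] := Ax [set y | `|x - y| < e].
  by apply/nbhs_normP; exists e.
by move=> y [Ay xy]; exists y.
Qed.

Lemma bound_normr (K : numDomainType) (V W : normedZmodType K) (v : V) (w : W)
    (c : K) : `|v| <= c * `|w| -> `|v| <= `|c| * `|w|.
Proof.
move=> vcw; have cw : 0 <= c * `|w| by apply: le_trans vcw.
by rewrite -[`|w|]normr_id -normrM (ger0_norm cw).
Qed.

Lemma functional_vanish (K : numFieldType) (V : normedModType K) (d : V -> K)
    (c : K) (A : set V) :
  {morph d : x y / x - y} -> (forall x, `|d x| <= c * `|x|) ->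
  (forall x, A x -> d x = 0) -> forall x, closure A x -> d x = 0.
Proof.
move=> dB dc dA x Ax; apply/eqP; rewrite -normr_le0.
apply/ler_addgt0Pl => e e0; rewrite addr0.
have c1 : 0 < `|c| + 1 by rewrite ltr_wpDl.
have [y Ay xy] := closure_approx Ax (divr_gt0 e0 c1).
have -> : d x = d (x - y) by rewrite dB (dA _ Ay) subr0.
apply: le_trans (ltW (_ : (`|c| + 1) * `|x - y| < e)); last first.
  by rewrite mulrC -ltr_pdivlMr.
by apply: le_trans (bound_normr (dc _)) _; rewrite ler_wpM2r // lerDl.
Qed.

Section Hilbert.
Variables (R : realType) (H : hilbertSpace R).
Local Notation dot := (dotp H).
Implicit Types (x y z : H) (T S : H -> H) (D : set H).

Lemma dotDl x y z : dot (x + y) z = dot x z + dot y z.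
Proof. exact: linearDl. Qed.
Lemma dotZl (a : R[i]) x z : dot (a *: x) z = a * dot x z.
Proof. exact: linearZl_LR. Qed.
Lemma dotDr x y z : dot z (x + y) = dot z x + dot z y.
Proof. exact: linearDr. Qed.
Lemma dotZr (a : R[i]) x z : dot z (a *: x) = Num.conj a * dot z x.
Proof. exact: linearZr_LR. Qed.
Lemma dotBl x y z : dot (x - y) z = dot x z - dot y z.
Proof. exact: linearBl. Qed.
Lemma dotBr x y z : dot z (x - y) = dot z x - dot z y.
Proof. exact: linearBr. Qed.
Lemma dot0l z : dot 0 z = 0.
Proof. exact: linear0l. Qed.
Lemma dot0r z : dot z 0 = 0.
Proof. exact: linear0r. Qed.
Lemma dotC x y : dot x y = Num.conj (dot y x).
Proof. by rewrite (hermC (dotp H)) expr0 mul1r. Qed.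
Lemma dot_suml (J : Type) (r : seq J) (f : J -> H) z :
  dot (\sum_(i <- r) f i) z = \sum_(i <- r) dot (f i) z.
Proof. by elim/big_rec2: _ => [|i u v _ <-]; rewrite ?dot0l ?dotDl. Qed.
Lemma dot_sumr (J : Type) (r : seq J) (f : J -> H) z :
  dot z (\sum_(i <- r) f i) = \sum_(i <- r) dot z (f i).
Proof. by elim/big_rec2: _ => [|i u v _ <-]; rewrite ?dot0r ?dotDr. Qed.

Lemma dot_eq0 x : dot x x = 0 -> x = 0.
Proof. by move/eqP; rewrite dnorm_eq0 => /eqP. Qed.

Lemma cauchy_schwarz x y : `|dot x y| <= `|x| * `|y|.
Proof.
rewrite -(ler_sqr (x := `|dot x y|)) ?nnegrE ?mulr_ge0 //.
have [->|y0] := eqVneq y 0.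
  by rewrite dot0r normr0 expr0n exprn_ge0 // mulr_ge0.
have ny : 0 < dot y y by rewrite dnorm_gt0.
pose t := dot x y / dot y y.
have : 0 <= dot (x - t *: y) (x - t *: y) by [].
rewrite !(dotBl, dotBr, dotZl, dotZr).
have tyy : t * dot y y = dot x y by rewrite /t divfK ?gt_eqF.
rewrite (mulrCA t) tyy opprB addrA subrK /t (dotC y x) subr_ge0 mulrAC -normCK.
by rewrite ler_pdivrMr // -!dotp_norm exprMn.
Qed.

Lemma bounded_op_ge0 T : bounded_op T ->
  linear T /\ exists2 c : R[i], 0 <= c & forall x, `|T x| <= c * `|x|.
Proof.
case=> linT [c Tc]; split=> //; exists `|c| => // x.
exact: bound_normr (Tc x).
Qed.

Lemma bounded_op_lin (a : R[i]) T S : bounded_op T -> bounded_op S ->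
  bounded_op (a *: T + S).
Proof.
move=> /bounded_op_ge0 [linT [c c0 Tc]] /bounded_op_ge0 [linS [d d0 Sd]].
split.
  move=> b x y; rewrite /= !fctE linT linS !scalerDr !scalerA mulrC.
  by rewrite -!scalerA addrACA.
exists (`|a| * c + d) => x; rewrite mulrDl -mulrA.
apply: le_trans (ler_normD _ _) _; rewrite lerD // normrZ ler_wpM2l //.
Qed.

Lemma dense_orthogonal D x : closure D = [set: H] ->
  (forall y, D y -> dot x y = 0) -> x = 0.
Proof.
move=> dD Dx; apply/normr0_eq0/eqP; rewrite eq_le normr_ge0 andbT.
apply/ler_addgt0Pl => e e0; rewrite addr0.
have [y Dy xy] : exists2 y, D y & `|x - y| < e.
  by apply: closure_approx e0; rewrite dD.
have [->|x0] := eqVneq x 0; first by rewrite normr0 ltW.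
have nx : 0 < `|x| by rewrite normr_gt0.
rewrite -(ler_pM2l nx) -expr2 dotp_norm.
have -> : dot x x = `|dot x (x - y)|.
  by rewrite dotBr (Dx _ Dy) subr0 ger0_norm.
apply: le_trans (cauchy_schwarz _ _) _; rewrite ler_pM2l //; exact: ltW.
Qed.

Lemma dense_bound D T (c : R[i]) : closure D = [set: H] -> bounded_op T ->
  0 <= c -> (forall x, D x -> `|T x| <= c * `|x|) ->
  forall x, `|T x| <= c * `|x|.
Proof.
move=> dD /bounded_op_ge0 [linT [d d0 Td]] c0 Dc x.
have k0 : 0 < d + c + 1 by rewrite ltr_wpDl // addr_ge0.
apply/ler_addgt0Pl => e e0.
have [y Dy xy] : exists2 y, D y & `|x - y| < e / (d + c + 1).
  by apply: closure_approx; rewrite ?dD // divr_gt0.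
have -> : T x = T (x - y) + T y.
  by have := linT 1 (x - y) y; rewrite !scale1r subrK.
apply: le_trans (ler_normD _ _) _.
have ye : `|y| <= `|x - y| + `|x|.
  by rewrite -{1}(subrK x y) (distrC x) ler_normD.
apply: (@le_trans _ _ (d * `|x - y| + c * (`|x - y| + `|x|))).
  by rewrite lerD // (le_trans (Dc _ Dy)) // ler_wpM2l.
rewrite mulrDr addrA -mulrDl lerD2r.
rewrite ltr_pdivlMr // in xy; apply: le_trans (ltW xy).
by rewrite mulrC ler_wpM2l // lerDl.
Qed.

End Hilbert.

(** The inequality |T x| <= c |x| in the form c^2 - T^* T >= 0, without the
adjoint. *)
Lemma pos_kernel_bound (R : realType) (H : hilbertSpace R) (T : H -> H)
    (c : R[i]) : linear T -> 0 <= c -> (forall x, `|T x| <= c * `|x|) ->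
  pos_kernel (fun x y => c ^+ 2 * dotp H x y - dotp H (T x) (T y)).
Proof.
move=> linT c0 Tc; split=> [x y|n x a].
  by rewrite rmorphB rmorphM /= (geC0_conj (exprn_ge0 2 c0)) -!dotC.
have E (f : H -> H) : linear f ->
    \sum_i \sum_j a i * Num.conj (a j) * dotp H (f (x i)) (f (x j)) =
    `|f (\sum_i a i *: x i)| ^+ 2.
  move=> lf; rewrite dotp_norm (lin_sum lf) dot_suml; apply: eq_bigr => i _.
  rewrite (linZ lf) dotZl dot_sumr mulr_sumr; apply: eq_bigr => j _.
  by rewrite (linZ lf) dotZr mulrA.
have -> : \sum_i \sum_j a i * Num.conj (a j) *
    (c ^+ 2 * dotp H (x i) (x j) - dotp H (T (x i)) (T (x j))) =
    c ^+ 2 * `|\sum_i a i *: x i| ^+ 2 - `|T (\sum_i a i *: x i)| ^+ 2.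
  rewrite -(E _ linT) -(E id) // mulr_sumr -sumrB; apply: eq_bigr => i _.
  rewrite mulr_sumr -sumrB; apply: eq_bigr => j _.
  by rewrite mulrBr mulrCA.
by rewrite subr_ge0 -exprMn ler_sqr ?nnegrE // mulr_ge0.
Qed.

Lemma pos_kernel_dot (R : realType) (H : hilbertSpace R) : pos_kernel (dotp H).
Proof.
have := @pos_kernel_bound R H (fun=> 0) 1.
have -> : (fun x y : H => 1 ^+ 2 * dotp H x y - dotp H 0 0) = dotp H.
  by apply/funext => x; apply/funext => y; rewrite expr1n mul1r dot0l subr0.
apply=> // [a x y|x]; first by rewrite scaler0 addr0.
by rewrite normr0 mul1r.
Qed.

(** The order of K need not be total, so that the minimum of d and e is not at
hand. *)
Lemma common_lower_bound (K : numFieldType) (d e : K) : 0 < d -> 0 < e ->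
  exists m, [/\ 0 < m, m <= d & m <= e].
Proof.
move=> d0 e0; exists (d * e / (d + e)).
split; first by rewrite divr_gt0 ?mulr_gt0 ?addr_gt0.
  rewrite -mulrA ler_piMr ?(ltW d0) // ler_pdivrMr ?addr_gt0 //.
  by rewrite mul1r lerDr ltW.
rewrite mulrAC ler_piMl ?(ltW e0) // ler_pdivrMr ?addr_gt0 //.
by rewrite mul1r lerDl ltW.
Qed.

Lemma lin_onB (K : numFieldType) (V W : lmodType K) (P : set V) (f : V -> W) :
  (forall a x y, P x -> P y -> f (a *: x + y) = a *: f x + f y) ->
  forall x y, P x -> P y -> f (x - y) = f x - f y.
Proof.
move=> flin x y Px Py; have := flin (-1) y x Py Px.
by rewrite !scaleN1r addrC => ->; rewrite addrC.
Qed.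

(** Extension by continuity of a bounded linear map given on a dense subspace,
where that subspace is presented by a linear parametrization [i] of its points
by [P].  The estimate against every [i x] encodes at once that L extends f, that
it is bounded, and that it is unique. *)
Lemma extend_bounded (K : numFieldType) (X : lmodType K) (V : normedModType K)
    (W : completeNormedModType K) (P : set X) (i : X -> V) (f : X -> W)
    (c : K) :
  (forall a x y, P x -> P y -> P (a *: x + y)) ->
  (forall a x y, P x -> P y -> i (a *: x + y) = a *: i x + i y) ->
  (forall a x y, P x -> P y -> f (a *: x + y) = a *: f x + f y) ->
  0 <= c -> (forall x, P x -> `|f x| <= c * `|i x|) ->
  closure (i @` P) = [set: V] ->
  exists L : V -> W, linear L /\
    forall v x, P x -> `|L v - f x| <= c * `|v - i x|.
Proof.
move=> Plin ilin flin c0 fi dense.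
have iB := lin_onB ilin; have fB := lin_onB flin.
have PB x y : P x -> P y -> P (x - y).
  by move=> Px Py; have := Plin (-1) y x Py Px; rewrite scaleN1r addrC.
have approx v e : 0 < e -> exists2 x, P x & `|v - i x| < e.
  move=> e0; have [|_ [x Px <-] vx] := @closure_approx _ _ (i @` P) v _ e e0.
    by rewrite dense.
  by exists x.
have lim v : exists w, forall x, P x -> `|w - f x| <= c * `|v - i x|.
  (* The filter of the values f x for i x close to v is Cauchy. *)
  pose F : set_system W := [set B | exists2 e, 0 < e &
    forall x, P x -> `|v - i x| < e -> B (f x)].
  have Ff : ProperFilter F.
    apply: Build_ProperFilter_ex.
      move=> B [e e0 eB]; have [x Px /eB] := approx v e e0.
      by exists (f x); auto.
    split.
    - by exists 1.
    - move=> A B [d d0 dA] [e e0 eB].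
      have [m [m0 md me]] := common_lower_bound d0 e0.
      exists m => // x Px vx; split.
        by apply: dA => //; apply: lt_le_trans md.
      by apply: eB => //; apply: lt_le_trans me.
    - move=> A B AB [e e0 eA]; exists e => // x Px vx; exact/AB/eA.
  have c1 : 0 < c + 1 by rewrite ltr_wpDl.
  have Fc : cauchy F.
    apply: cauchy_exP => e e0.
    have e' : 0 < e / (c + 1) / 2 by rewrite !divr_gt0.
    have [y Py vy] := approx v _ e'.
    exists (f y); exists (e / (c + 1) / 2) => // x Px vx.
    rewrite -ball_normE /= -fB //; apply: le_lt_trans (fi _ (PB _ _ Py Px)) _.
    rewrite iB //.
    have d : `|i y - i x| < e / (c + 1).
      have -> : i y - i x = (v - i x) - (v - i y).
        by rewrite opprB [RHS]addrC addrA subrK.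
      rewrite (le_lt_trans (ler_normB _ _)) // [ltRHS]splitr ltrD //.
    rewrite ltr_pdivlMr // in d; apply: le_lt_trans d.
    by rewrite mulrC ler_wpM2l // lerDl.
  have /cvg_ex [w Fw] : cvg F by apply/cauchy_cvgP.
  exists w => x Px; apply/ler_addgt0Pl => e e0.
  have [d d0 dw] : F [set z | `|w - z| < e / 2].
    by apply: Fw; apply/nbhs_normP; exists (e / 2) => //=; rewrite divr_gt0.
  have e' : 0 < e / 2 / (c + 1) by rewrite !divr_gt0.
  have [m [m0 md me]] := common_lower_bound d0 e'.
  have [y Py vy] := approx v m m0.
  have -> : w - f x = (w - f y) + f (y - x) by rewrite fB // addrA subrK.
  apply: le_trans (ler_normD _ _) _.
  rewrite [e]splitr -addrA lerD //; first exact/ltW/dw/(lt_le_trans vy).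
  apply: le_trans (fi _ (PB _ _ Py Px)) _; rewrite iB //.
  have -> : i y - i x = (v - i x) - (v - i y).
    by rewrite opprB [RHS]addrC addrA subrK.
  apply: (@le_trans _ _ (c * (`|v - i x| + `|v - i y|))).
    by rewrite ler_wpM2l // ler_normB.
  rewrite mulrDr [leRHS]addrC lerD2l.
  have := lt_le_trans vy me; rewrite ltr_pdivlMr // => vy'.
  by apply: le_trans (ltW vy'); rewrite mulrC ler_wpM2l // lerDl.
have [L LP] := choice lim; exists L; split; last by [].
move=> a u v; apply/eqP; rewrite -subr_eq0 -normr_eq0 eq_le normr_ge0 andbT.
apply/ler_addgt0Pl => e e0; rewrite addr0.
have k0 : 0 < (c + 1) * (`|a| + 1) * 2.
  by rewrite !mulr_gt0 // ltr_wpDl.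
have d0 : 0 < e / ((c + 1) * (`|a| + 1) * 2) by rewrite divr_gt0.
have [x Px ux] := approx u _ d0; have [y Py vy] := approx v _ d0.
pose z := a *: x + y.
have -> : L (a *: u + v) - (a *: L u + L v) =
    (L (a *: u + v) - f z) - (a *: (L u - f x) + (L v - f y)).
  have -> : a *: (L u - f x) + (L v - f y) = (a *: L u + L v) - f z.
    by rewrite scalerBr addrACA -opprD flin.
  by rewrite opprB addrA subrK.
apply: le_trans (ler_normB _ _) _.
have b1 : `|L (a *: u + v) - f z| <= c * (`|a| * `|u - i x| + `|v - i y|).
  apply: le_trans (LP _ _ (Plin _ _ _ Px Py)) _; rewrite ler_wpM2l // ilin //.
  have -> : a *: u + v - (a *: i x + i y) = a *: (u - i x) + (v - i y).
    by rewrite scalerBr opprD addrACA.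
  by rewrite -normrZ ler_normD.
have b2 : `|a *: (L u - f x) + (L v - f y)| <=
    c * (`|a| * `|u - i x| + `|v - i y|).
  rewrite mulrDr mulrCA; apply: le_trans (ler_normD _ _) _.
  by rewrite normrZ lerD ?ler_wpM2l ?LP.
apply: le_trans (lerD b1 b2) _.
rewrite -mulr2n -mulr_natr.
have b3 : `|a| * `|u - i x| + `|v - i y| <=
    (`|a| + 1) * (e / ((c + 1) * (`|a| + 1) * 2)).
  by rewrite mulrDl mul1r lerD ?ler_wpM2l // ltW.
have {}b3 : c * (`|a| * `|u - i x| + `|v - i y|) <=
    (c + 1) * ((`|a| + 1) * (e / ((c + 1) * (`|a| + 1) * 2))).
  by rewrite ler_pM ?addr_ge0 ?mulr_ge0 ?lerDl.
apply: le_trans (ler_wpM2r _ b3) _ => //.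
have c1 : c + 1 != 0 by rewrite gt_eqF // ltr_wpDl.
have a1 : `|a| + 1 != 0 by rewrite gt_eqF // ltr_wpDl.
by rewrite le_eqVlt; apply/orP; left; apply/eqP; field; rewrite c1 a1.
Qed.

Lemma ge0_approx (K : numFieldType) (z : K) :
  (forall e, 0 < e -> exists2 w, 0 <= w & `|z - w| <= e) -> 0 <= z.
Proof.
move=> zw; suff -> : z = `|z| by [].
apply/eqP; rewrite -subr_eq0 -normr_le0; apply/ler_addgt0Pl => e e0.
rewrite addr0; have [w w0 zwe] := zw _ (divr_gt0 e0 (ltr0Sn K 1)).
have -> : z - `|z| = (z - w) + (`|w| - `|z|).
  by rewrite (ger0_norm w0) addrA subrK.
rewrite (le_trans (ler_normD _ _)) // [e]splitr lerD //.
by apply: le_trans (ler_dist_dist _ _) _; rewrite distrC.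
Qed.

(** * Normal functionals and tensor products *)

Section Normal.
Variables (R : realType) (H : hilbertSpace R) (M : set (H -> H)).
Implicit Types (T S : H -> H) (f : (H -> H) -> R[i]).

(** The sequences of vectors continue with zeros. *)
Lemma finite_normal_functional (s : seq (H * H)) f :
  (forall T, M T -> f T = \sum_(p <- s) dotp H (T p.1) p.2) ->
  normal_functional M f.
Proof.
move=> fE; pose z k := nth (0, 0) s k.
have z0 k : (size s <= k)%N -> z k = (0, 0) by move=> ?; rewrite /z nth_default.
have bd (g : H * H -> H) : g (0, 0) = 0 ->
    exists c : R[i], forall n, \sum_(k < n) `|g (z k)| ^+ 2 <= c.
  move=> g0; exists (\sum_(k < size s) `|g (z k)| ^+ 2) => n.
  have gz k : (size s <= k)%N -> `|g (z k)| ^+ 2 = 0.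
    by move=> /z0 ->; rewrite g0 normr0 expr0n.
  rewrite -(@sum_trunc _ (fun k => `|g (z k)| ^+ 2) _ (size s + n) gz) ?leq_addr //.
  rewrite addnC big_split_ord /= lerDl sumr_ge0 // => k _; exact: exprn_ge0.
exists (fun k => (z k).1), (fun k => (z k).2); split; [exact: bd|exact: bd|].
move=> T MT; apply: cvg_near_cst; exists (size s) => // n /= sn.
rewrite /series /= big_mkord fE //.
rewrite (@sum_trunc _ (fun k => dotp H (T (z k).1) (z k).2) (size s)) //.
  2: by move=> k /z0 ->; rewrite dot0r.
by rewrite (big_nth (0, 0)) big_mkord.
Qed.

Lemma normal_functional_lin f (a : R[i]) T S : normal_functional M f ->
  M T -> M S -> M (a *: T + S) -> f (a *: T + S) = a * f T + f S.
Proof.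
case=> xi [eta [_ _ fl]] MT MS MTS; have flT := fl _ MT; have flS := fl _ MS.
apply: (norm_cvg_unique (fl _ MTS)).
apply: cvg_trans (cvgD (cvgZl_tmp (k := a) flT) flS).
apply: near_eq_cvg; apply: nearW => n /=.
rewrite !fctE /series /= scaler_sumr -big_split; apply: eq_bigr => k _ /=.
by rewrite dotDl dotZl.
Qed.
End Normal.

Section Tensor.
Variables (R : realType) (H : hilbertSpace R) (HH : tensorSquare H).

(** The difference of the two sides is a combination of elementary tensors, and it
is orthogonal to every elementary tensor. *)
Lemma tens_linl y : linear (tens HH ^~ y).
Proof.
move=> a x x'; apply/eqP; rewrite -subr_eq0; apply/eqP/dot_eq0.
set d := _ - _.
have d0 p q : dotp HH d (tens HH p q) = 0.
  rewrite /d !(dotBl, dotDl, dotZl, tens_dot); ring.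
by rewrite {2}/d dotBr dotDr dotZr !d0 mulr0 addr0 subr0.
Qed.

Lemma tens_linr x : linear (tens HH x).
Proof.
move=> a y y'; apply/eqP; rewrite -subr_eq0; apply/eqP/dot_eq0.
set d := _ - _.
have d0 p q : dotp HH d (tens HH p q) = 0.
  rewrite /d !(dotBl, dotDl, dotZl, tens_dot); ring.
by rewrite {2}/d dotBr dotDr dotZr !d0 mulr0 addr0 subr0.
Qed.
End Tensor.
Arguments tens_linl {R H} HH y.
Arguments tens_linr {R H} HH x.

(** * Coefficients of representations and the antipode *)

Section QuantumGroup.
Variables (R : realType) (G : compactQG R) (I : irrSystem G).
Local Notation H := (L2 G).
Local Notation HH := (L2L2 G).
Local Notation C := R[i].
Local Notation u := (@irr_u _ _ I).
Implicit Types (S T Q : op H).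

Lemma Linf_bounded T : Linf G T -> bounded_op T.
Proof. by case: (Linf_vN G) => _ <- []. Qed.

Lemma Linf_linear T : Linf G T -> linear T.
Proof. by case/Linf_bounded. Qed.

Lemma cop_bounded T : Linf G T -> bounded_op (cop T).
Proof. by move/cop_Linf => []. Qed.

Lemma Pol_Linf T : Pol I T -> Linf G T.
Proof.
rewrite -(irr_dense_Linf I) => PT; have [Pb _ _ _ _] := irr_star_subalgebra I.
by split=> [|S [_ cS]]; [exact: Pb|rewrite cS].
Qed.

Lemma Pol0 : Pol I (0 : op H).
Proof.
have [_ P1 Pl _ _] := irr_star_subalgebra I.
by have := Pl (-1) _ _ P1 P1; rewrite scaleN1r addNr.
Qed.

Lemma Pol_lin (a : C) T S : Pol I T -> Pol I S -> Pol I (a *: T + S).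
Proof. by have [_ _ Pl _ _] := irr_star_subalgebra I; apply: Pl. Qed.

Lemma Pol_u p i j : Pol I (u p i j).
Proof.
exists 1%N, (fun=> 1), (fun=> u p i j).
by rewrite big_ord1 scale1r; split=> // _; exists p, i, j.
Qed.

Lemma Pol_sum (J : eqType) (r : seq J) (c : J -> C) (f : J -> op H) :
  {in r, forall k, Pol I (f k)} -> Pol I (\sum_(k <- r) c k *: f k).
Proof.
move=> Pf; rewrite big_seq; elim/big_rec: _ => [|k x kr Px]; first exact: Pol0.
by apply: Pol_lin => //; exact: Pf.
Qed.

Definition Pol_scalar (f : op H -> C) : Prop := forall c S T,
  Pol I S -> Pol I T -> f (c *: S + T) = c * f S + f T.

Lemma Pol_scalar0 (f : op H -> C) : Pol_scalar f -> f 0 = 0.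
Proof.
move=> fl; have := fl (-1) _ _ Pol0 Pol0.
by rewrite scaler0 addr0 mulN1r addNr.
Qed.

Lemma Pol_scalar_sum (J : eqType) (r : seq J) (c : J -> C) (k : J -> op H)
    (f : op H -> C) : Pol_scalar f -> {in r, forall j, Pol I (k j)} ->
  f (\sum_(j <- r) c j *: k j) = \sum_(j <- r) c j * f (k j).
Proof.
move=> fl; elim: r => [|j r IH] Pk; first by rewrite !big_nil Pol_scalar0.
have Pr : {in r, forall j, Pol I (k j)}.
  by move=> i ir; apply: Pk; exact: mem_behead.
rewrite !big_cons fl ?IH //; first by apply: Pk; exact: mem_head.
exact: Pol_sum.
Qed.

Lemma normal_Pol_scalar nu : normal_functional (Linf G) nu -> Pol_scalar nu.
Proof.
move=> nf c S T PS PT; have PcST := Pol_lin c PS PT.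
exact: (normal_functional_lin nf (Pol_Linf PS) (Pol_Linf PT) (Pol_Linf PcST)).
Qed.

Lemma Pol_ind (Q : op H -> Prop) : Q 0 ->
  (forall c p i j S, Pol I S -> Q S -> Q (c *: u p i j + S)) ->
  forall S, Pol I S -> Q S.
Proof.
move=> Q0 Ql; suff : Pol I `<=` [set S | Pol I S /\ Q S].
  by move=> h S /h [].
apply: lin_span_ind; first by split=> //; exact: Pol0.
move=> c _ S [p [i [j ->]]] [PS QS]; split; last exact: Ql.
by apply: Pol_lin => //; apply: Pol_u.
Qed.

Lemma cop0 : cop (0 : op H) = 0 :> op HH.
Proof.
have L0 := Pol_Linf Pol0; have := cop_linear (-1) L0 L0.
by rewrite scaler0 addr0 scaleN1r addNr.
Qed.

Lemma copZ (a : C) T : Linf G T -> cop (a *: T) = a *: cop T :> op HH.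
Proof.
by move=> LT; have := cop_linear a LT (Pol_Linf Pol0); rewrite cop0 !addr0.
Qed.

(** The identity \sum_z cop(z.1)(1 (x) z.2) = a (x) 1 between operators on
L^2 (x) L^2, tested on elementary tensors. *)
Definition untwists (a : op H) (zs : seq (op H * op H)) : Prop :=
  (forall z, z \in zs -> Pol I z.1 /\ Pol I z.2) /\
  forall x y, \sum_(z <- zs) cop z.1 (tens HH x (z.2 y)) = tens HH (a x) y.

Lemma Pol_adjoint T S : Pol I T -> adjoint T S -> Pol I S.
Proof.
move=> PT aTS; have [_ _ _ _ /(_ _ PT) [S' [PS' aTS']]] := irr_star_subalgebra I.
suff -> : S = S' by [].
apply/funext => y; apply/eqP; rewrite -subr_eq0; apply/eqP/dot_eq0.
by rewrite dotBr -aTS -aTS' subrr.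
Qed.

(** For a = u_ij the tensor \sum_t u_it (x) u_jt^* does it, by unitarity of u; the
second legs are the values of the antipode on the u_tj. *)
Lemma untwist_exists a : Pol I a -> exists zs, untwists a zs.
Proof.
move: a; apply: Pol_ind => [|c p i j S _ [zs [Pzs zsE]]].
  exists [::]; split=> // x y; rewrite big_nil.
  by rewrite (lin0 (tens_linl HH y)).
have [Lu [v [av _ uv]] Du] := irr_unitary (i := I) p.
have Pv k l : Pol I (v k l) by exact: Pol_adjoint (Pol_u k l) (av k l).
pose us := [seq (c *: u p i t, v j t) | t <- enum 'I_(irr_dim p)].
exists (us ++ zs); split.
  move=> z; rewrite mem_cat => /orP[|/Pzs //] /mapP[t _ ->] /=; split=> //.
  rewrite -[_ *: _]addr0; exact/Pol_lin/Pol0/Pol_u.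
move=> x y; rewrite big_cat zsE big_map big_enum /=.
rewrite (linD (tens_linl HH y)) (linZ (tens_linl HH y)); congr (_ + _).
have scE (X : op HH) z : (c *: X) z = c *: X z by [].
under eq_bigr => t _ do rewrite copZ // scE Du.
rewrite -scaler_sumr exchange_big /=; congr (_ *: _).
under eq_bigr => s _ do rewrite -(lin_sum (tens_linr HH _)).
have uvy s : \sum_t u p s t (v j t y) = (s == j)%:R *: y.
  by have := congr1 (fun f : op H => f y) (uv s j); rewrite fct_sumE.
under eq_bigr => s _ do rewrite uvy.
rewrite (bigD1 j) //= big1 ?addr0 ?eqxx ?scale1r // => s /negPf ->.
by rewrite scale0r (lin0 (tens_linr HH _)).
Qed.
End QuantumGroup.

(** * States on C*-algebras *)

Section State.
Variables (R : realType) (A : cstarAlgebra R) (f : A -> R[i]).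
Hypothesis fstate : state_on [set: A] f.
Implicit Types x y z : A.

Lemma state_scalar : scalar f.
Proof. by case: fstate => [[flin _] _ _] c x y; apply: flin. Qed.

Lemma cstar_sum (J : Type) (r : seq J) (c : J -> R[i]) (x : J -> A) :
  cstar (\sum_(k <- r) c k *: x k) = \sum_(k <- r) Num.conj (c k) *: cstar (x k).
Proof.
elim: r => [|k r IH]; last by rewrite !big_cons cstar_linear IH.
rewrite !big_nil; have := cstar_linear (-1) (0 : A) 0.
by rewrite scaler0 addr0 rmorphN rmorph1 scaleN1r addNr.
Qed.

Lemma cmul_suml (J : Type) (r : seq J) (c : J -> R[i]) (x : J -> A) z :
  cmul (\sum_(k <- r) c k *: x k) z = \sum_(k <- r) c k *: cmul (x k) z.
Proof.
have l : linear (fun w : A => cmul w z) by move=> a u v; exact: cmul_linearl.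
by rewrite (lin_sum l); apply: eq_bigr => k _; rewrite (linZ l).
Qed.

Lemma cmul_sumr (J : Type) (r : seq J) (c : J -> R[i]) (x : J -> A) z :
  cmul z (\sum_(k <- r) c k *: x k) = \sum_(k <- r) c k *: cmul z (x k).
Proof.
have l : linear (fun w : A => cmul z w) by move=> a u v; exact: cmul_linearr.
by rewrite (lin_sum l); apply: eq_bigr => k _; rewrite (linZ l).
Qed.

Lemma state_sum (J : Type) (r : seq J) (c : J -> R[i]) (x : J -> A) :
  f (\sum_(k <- r) c k *: x k) = \sum_(k <- r) c k * f (x k).
Proof.
rewrite (lin_sum (W := R[i]^o) state_scalar); apply: eq_bigr => k _.
exact: (linZ (W := R[i]^o) state_scalar).
Qed.

(** Hermitian symmetry is polarization: the form is real on the diagonal at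
x + y and at i x + y. *)
Lemma state_kernel : pos_kernel (fun x y => f (cmul (cstar y) x)).
Proof.
have fpos x : 0 <= f (cmul (cstar x) x) by case: fstate => _ _; apply.
split=> [x y|n x c]; last first.
  suff -> : \sum_i \sum_j c i * Num.conj (c j) * f (cmul (cstar (x j)) (x i)) =
      f (cmul (cstar (\sum_i c i *: x i)) (\sum_i c i *: x i)) by [].
  rewrite cmul_sumr state_sum; apply: eq_bigr => i _.
  rewrite cstar_sum cmul_suml state_sum mulr_sumr; apply: eq_bigr => j _.
  by rewrite mulrA.
set q := fun x y => f (cmul (cstar y) x).
have real x' : Num.conj (q x' x') = q x' x' by rewrite geC0_conj // /q.
have expand (a : R[i]) :
    q (a *: x + y) (a *: x + y) =
    a * (Num.conj a * q x x + q x y) + (Num.conj a * q y x + q y y).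
  rewrite /q cstar_linear cmul_linearr state_scalar !cmul_linearl !state_scalar.
  by [].
have := real (1 *: x + y); have := real ('i *: x + y).
rewrite !expand /= !(rmorphD, rmorphM, rmorphN) /= !conjCK conjCi rmorph1.
rewrite !real !mul1r.
move=> e1 e2; rewrite -[LHS]/(q x y) -[f _]/(q y x).
move: e1 e2; move: (q x x) (q y y) (q x y) (q y x) => X Y a b.
move: (Num.conj a) (Num.conj b) => a' b' e1 e2.
have i2 : 'i * 2 != 0 :> R[i] by rewrite mulf_neq0 ?neq0Ci ?pnatr_eq0.
apply: (mulfI i2); apply/eqP; rewrite -subr_eq0 -mulrBr.
have -> : 'i * 2 * (a - b') =
    'i * (- 'i * X + a) + (- 'i * b + Y) - (- 'i * ('i * X + a') + ('i * b' + Y))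
    + 'i * (X + a + (b + Y) - (X + a' + (b' + Y))) by ring.
by rewrite e1 e2 !subrr mulr0 addr0.
Qed.
End State.

Lemma cstar_isometry (R : realType) (A : cstarAlgebra R) (x : A) :
  `|cstar x| = `|x|.
Proof.
have le y : `|y : A| <= `|cstar y|.
  have [->|y0] := eqVneq y 0; first by rewrite normr0.
  have ny : 0 < `|y| by rewrite normr_gt0.
  by rewrite -(ler_pM2r ny) -expr2 -cstar_norm cmul_norm.
by apply/eqP; rewrite eq_le le -{2}(cstarK x) le.
Qed.

Lemma dual_bound (R : realType) (A : cstarAlgebra R) (S : set A) (f : A -> R[i]) :
  dual_on S f -> exists2 c : R[i], 0 <= c & forall x, S x -> `|f x| <= c * `|x|.
Proof.
by move=> [_ [c fc]]; exists `|c| => // x Sx; exact: bound_normr (fc x Sx).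
Qed.

(** * Convolution by a state on the coefficient algebra *)

Section Convolution.
Variables (R : realType) (G : compactQG R) (I : irrSystem G).
Variables (Cu : completion (Pol I)) (om : Cu -> R[i]).
Hypothesis om_state : state_on [set: Cu] om.
Local Notation H := (L2 G).
Local Notation HH := (L2L2 G).
Local Notation C := R[i].
Local Notation u := (@irr_u _ _ I).
Local Notation g := (fun T => om (co_in Cu T)).
Local Notation h0 := (haar G).
Implicit Types (S T Q a b : op H).

Lemma om_Pol_scalar : Pol_scalar I g.
Proof.
move=> c S T PS PT; case: (co_in_hom Cu) => -> // _ _ _.
exact: state_scalar om_state _ _ _.
Qed.

(** Q = (w_(x, y) (x) id)(cop S), where w_(x, y)(T) = <T x, y>. *)
Definition slice_of S (x y : H) Q : Prop := forall v w,
  dotp HH (cop S (tens HH x v)) (tens HH y w) = dotp H (Q v) w.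

(** The GNS form of om on Pol. *)
Definition om_form (y y' : op H) : C :=
  om (cmul (cstar (co_in Cu y')) (co_in Cu y)).

(** Invariance of h gives h(x'^* S x) 1 = (h (x) id)(cop(x'^* S x)).  Multiplying
by y on the right and by y'^* on the left, and summing over the two tensors,
turns the legs cop(x)(1 (x) y) into a (x) 1 and b (x) 1: thus
\sum h(x'^* S x) y'^* y is the slice of cop(S) by a h and b h. *)
Lemma slice_twist S a b za zb Q : Pol I S -> Pol I Q ->
  untwists I a za -> untwists I b zb -> slice_of S (a h0) (b h0) Q ->
  g Q = \sum_(z <- za) \sum_(w <- zb)
          dotp H (S (z.1 h0)) (w.1 h0) * om_form z.2 w.2.
Proof.
move=> PS PQ [Pza zaE] [Pzb zbE] SQ.
have [_ _ _ PM Padj] := irr_star_subalgebra I.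
have /choice [st stP] T : exists T', Pol I T -> Pol I T' /\ adjoint T T'.
  case: (pselect (Pol I T)) => [PT|nT]; last by exists T.
  by have [T' ?] := Padj _ PT; exists T'.
pose s := [seq (z, w) | z <- za, w <- zb].
pose k (q : (op H * op H) * (op H * op H)) := dotp H (S (q.1.1 h0)) (q.2.1 h0).
pose f (q : (op H * op H) * (op H * op H)) : op H := st q.2.2 \o q.1.2.
have Pf : {in s, forall q, Pol I (f q)}.
  move=> _ /allpairsP[[z w] /= [/Pza[_ Pz] /Pzb[_ Pw] ->]].
  by apply: PM => //; case: (stP _ Pw).
suff QE : Q = \sum_(q <- s) k q *: f q.
  rewrite QE (Pol_scalar_sum _ om_Pol_scalar) // big_allpairs /= !big_seq.
  apply: eq_bigr => z zin.
  rewrite !big_seq; apply: eq_bigr => w win; congr (_ * _).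
  have [_ Pz] := Pza _ zin; have [_ Pw] := Pzb _ win.
  have [Ps As] := stP _ Pw; have [_ hM _ hS] := co_in_hom Cu.
  by rewrite /f /= hM // (hS _ _ Pw Ps As).
apply/funext => v; apply/eqP; rewrite -subr_eq0; apply/eqP/dot_eq0.
suff QE w : dotp H (Q v - (\sum_(q <- s) k q *: f q) v) w = 0 by rewrite QE.
apply/eqP; rewrite dotBl subr_eq0 -SQ -zaE -zbE.
have LS := Pol_Linf PS; have LcS := cop_bounded LS.
rewrite (lin_sum LcS.1) dot_suml fct_sumE dot_suml big_allpairs.
apply/eqP; rewrite !big_seq; apply: eq_bigr => z zin.
rewrite -big_seq dot_sumr big_seq [RHS]big_seq; apply: eq_bigr => z' zin'.
have [P1 P2] := Pza _ zin; have L1 := Pol_Linf P1; have [Pw1 Pw2] := Pzb _ zin'.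
have [Ps As] := stP _ Pw2; have [P1s A1s] := stP _ Pw1.
have Lw1 := Pol_Linf Pw1; have Ls1 := Pol_Linf P1s.
have adj (K : hilbertSpace R) (T T' : K -> K) x y :
    adjoint T T' -> dotp K (T' x) y = dotp K x (T y).
  by move=> A; rewrite dotC -A -dotC.
have PsSz : Pol I (st z'.1 \o (S \o z.1)) by exact: (PM _ _ P1s (PM _ _ PS P1)).
transitivity (dotp HH (cop (st z'.1 \o (S \o z.1)) (tens HH h0 (z.2 v)))
                (tens HH h0 (z'.2 w))).
  have -> : cop (st z'.1 \o (S \o z.1)) = cop (st z'.1) \o (cop S \o cop z.1).
    by rewrite (copM Ls1 (Pol_Linf (PM _ _ PS P1))) (copM LS L1).
  exact: esym (adj HH _ _ _ _ (cop_adj Lw1 Ls1 A1s)).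
rewrite (haar_invl _ _ (Pol_Linf PsSz)).
have -> : dotp H ((st z'.1 \o (S \o z.1)) h0) h0 = k (z, z').
  exact: (adj H _ _ _ _ A1s).
by rewrite -(adj H _ _ _ _ As) -dotZl.
Qed.

(** T = (id (x) om)(cop S), tested on the vector functional of each pair x, y:
since cop S lies in the algebraic tensor square of Pol, its slices lie in Pol,
where om is defined. *)
Definition om_convolved S T : Prop :=
  Pol I T /\ forall x y, exists Q, [/\ Pol I Q, slice_of S x y Q &
    g Q = dotp H (T x) y].

Definition u_conv p i j : op H := \sum_t g (u p t j) *: u p i t.

Lemma om_convolved_u p i j : om_convolved (u p i j) (u_conv i j).
Proof.
split; first by apply: Pol_sum => t _; exact: Pol_u.
move=> x y; exists (\sum_t dotp H (u p i t x) y *: u p t j); split.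
- by apply: Pol_sum => t _; exact: Pol_u.
- move=> v w; have [_ _ ->] := irr_unitary (i := I) p.
  rewrite fct_sumE !dot_suml; apply: eq_bigr => t _.
  by rewrite tens_dot -dotZl.
rewrite (Pol_scalar_sum _ om_Pol_scalar); last by move=> t _; exact: Pol_u.
rewrite /u_conv fct_sumE dot_suml; apply: eq_bigr => t _.
by rewrite mulrC -dotZl.
Qed.

Lemma om_convolved_lin (c : C) S S' T T' : Pol I S -> Pol I S' ->
  om_convolved S T -> om_convolved S' T' ->
  om_convolved (c *: S + S') (c *: T + T').
Proof.
move=> PS PS' [PT sT] [PT' sT']; split; first exact: Pol_lin.
move=> x y; have [Q [PQ SQ gQ]] := sT x y; have [Q' [PQ' SQ' gQ']] := sT' x y.
exists (c *: Q + Q'); split; first exact: Pol_lin.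
  move=> v w; rewrite (cop_linear c (Pol_Linf PS) (Pol_Linf PS')).
  by rewrite ![in LHS]fctE dotDl dotZl SQ SQ' -dotZl -dotDl.
by rewrite om_Pol_scalar // gQ gQ' -dotZl -dotDl.
Qed.

Lemma om_convolved0 : om_convolved 0 0.
Proof.
have z0 (K : hilbertSpace R) (Z : K -> K) (z w : K) : Z = 0 -> dotp K (Z z) w = 0.
  by move=> ->; exact: (dot0l w).
split=> [|x y]; first exact: Pol0.
exists 0; split; first exact: Pol0.
  by move=> v w; rewrite (z0 _ _ _ _ (cop0 I)) z0.
by rewrite (Pol_scalar0 om_Pol_scalar) z0.
Qed.

Lemma om_convolved_exists S : Pol I S -> exists T, om_convolved S T.
Proof.
move: S; apply: Pol_ind; first by exists 0; exact: om_convolved0.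
move=> c p i j S PS [T cT]; exists (c *: u_conv i j + T).
by apply: om_convolved_lin cT => //; [exact: Pol_u|exact: om_convolved_u].
Qed.

(** R(S) is the compression of S (x) 1 along a |-> zeta_a. *)
Lemma matrix_coef_twist S T a b za zb : Pol I S -> om_convolved S T ->
  untwists I a za -> untwists I b zb ->
  dotp H (T (a h0)) (b h0) = \sum_(z <- za) \sum_(w <- zb)
          dotp H (S (z.1 h0)) (w.1 h0) * om_form z.2 w.2.
Proof.
move=> PS [_ /(_ (a h0) (b h0)) [Q [PQ SQ <-]]] ua ub.
exact: slice_twist SQ.
Qed.

Lemma Pol_dense : closure [set x | exists2 a, Pol I a & x = a h0] = [set: H].
Proof.
rewrite -(irr_dense_L2 I); congr closure; apply/seteqP; split=> x.
  by case=> a; exists a.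
by case=> a []; exists a.
Qed.

Lemma bounded_op_eq T T' : bounded_op T -> bounded_op T' ->
  (forall a b, Pol I a -> Pol I b ->
     dotp H (T (a h0)) (b h0) = dotp H (T' (a h0)) (b h0)) -> T = T'.
Proof.
move=> bT bT' TT'; have bD := bounded_op_lin (-1) bT' bT.
apply/funext => x; apply/eqP; rewrite -subr_eq0 -normr_le0 -(mul0r `|x|).
have -> : T x - T' x = (-1 *: T' + T) x by rewrite !fctE scaleN1r addrC.
apply: (dense_bound Pol_dense bD) => // _ [a Pa ->].
rewrite mul0r normr_le0; apply/eqP/(dense_orthogonal Pol_dense) => _ [b Pb ->].
by rewrite !fctE dotDl dotZl mulN1r TT' // addNr.
Qed.

Lemma om_convolved_unique S T T' : Pol I S ->
  om_convolved S T -> om_convolved S T' -> T = T'.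
Proof.
move=> PS cT cT'; apply: bounded_op_eq; try exact: Linf_bounded (Pol_Linf _).
  exact: Linf_bounded (Pol_Linf cT.1).
  exact: Linf_bounded (Pol_Linf cT'.1).
move=> a b /untwist_exists[za ua] /untwist_exists[zb ub].
by rewrite (matrix_coef_twist PS cT ua ub) (matrix_coef_twist PS cT' ua ub).
Qed.

(** By uniqueness, a linear relation between S and R(S) only has to be checked on
the coefficients of representations. *)
Lemma om_convolved_functional (f f' : op H -> C) :
  Pol_scalar I f -> Pol_scalar I f' ->
  (forall p i j, f (@u_conv p i j) = f' (u p i j)) ->
  forall S T, Pol I S -> om_convolved S T -> f T = f' S.
Proof.
move=> fl fl' fu S T PS cT.
suff [T' cT' <-] : exists2 T', om_convolved S T' & f T' = f' S.
  by rewrite (om_convolved_unique PS cT cT').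
move: S PS {cT}; apply: Pol_ind.
  by exists 0; [exact: om_convolved0|rewrite (Pol_scalar0 fl) (Pol_scalar0 fl')].
move=> c p i j S PS [T' cT' e]; have cu := om_convolved_u i j.
have Pu := Pol_u i j; exists (c *: u_conv i j + T').
  exact: om_convolved_lin Pu PS cu cT'.
by rewrite (fl _ _ _ cu.1 cT'.1) (fl' _ _ _ Pu PS) fu e.
Qed.

Lemma R_graph_convolved S T : Pol I S -> om_convolved S T -> R_graph om S T.
Proof.
move=> PS cT; split; [exact: Pol_Linf PS|exact: Pol_Linf cT.1|].
move=> nu nu' nf nf' cv; have nul : Pol_scalar I nu by exact: normal_Pol_scalar.
have nul' : Pol_scalar I nu' by exact: normal_Pol_scalar.
apply: (om_convolved_functional nul nul' _ PS cT) => p i j.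
rewrite cv (Pol_scalar_sum _ nul); last by move=> t _; exact: Pol_u.
by apply: eq_bigr => t _; rewrite mulrC.
Qed.

(** For nu the vector functional of a h and b h with a, b in Pol, nu * om is the
normal functional X |-> <(X (x) 1) zeta_a, zeta_b>, so that the defining relation
of R_om applies to nu; these nu determine an operator. *)
Lemma R_graph_unique S T T' : Pol I S -> om_convolved S T -> R_graph om S T' ->
  T' = T.
Proof.
move=> PS cT [LS LT' RT']; have LT := Pol_Linf cT.1.
apply: bounded_op_eq; try exact: Linf_bounded.
move=> a b /untwist_exists[za ua] /untwist_exists[zb ub].
pose nu (X : op H) := dotp H (X (a h0)) (b h0).
pose nu' (X : op H) := \sum_(z <- za) \sum_(w <- zb)
  dotp H (X (z.1 h0)) (w.1 h0) * om_form z.2 w.2.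
rewrite (matrix_coef_twist PS cT ua ub) -/(nu' S) -/(nu T'); apply: RT'.
- apply: (@finite_normal_functional _ _ _ [:: (a h0, b h0)]) => X _.
  by rewrite big_seq1.
- apply: (@finite_normal_functional _ _ _
    [seq (q.1.1 h0, Num.conj (om_form q.1.2 q.2.2) *: q.2.1 h0) |
       q <- [seq (z, w) | z <- za, w <- zb]]).
  move=> X _; rewrite big_map big_allpairs; apply: eq_bigr => z _.
  by apply: eq_bigr => w _; rewrite dotZr conjCK mulrC.
move=> p i j.
have -> : nu' (u p i j) = dotp H (u_conv i j (a h0)) (b h0).
  exact: esym (matrix_coef_twist (Pol_u i j) (om_convolved_u i j) ua ub).
rewrite /u_conv fct_sumE dot_suml; apply: eq_bigr => t _.
by rewrite mulrC -dotZl.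
Qed.
End Convolution.

(** * Boundedness of convolution for the operator norm *)

Section Bound.
Variables (R : realType) (G : compactQG R) (I : irrSystem G).
Variables (Cu : completion (Pol I)) (om : Cu -> R[i]).
Hypothesis om_state : state_on [set: Cu] om.
Local Notation H := (L2 G).
Local Notation C := R[i].
Local Notation h0 := (haar G).

Lemma om_convolved1 : om_convolved om idfun idfun.
Proof.
have [_ P1 _ _ _] := irr_star_subalgebra I; split=> // x y.
exists (dotp H x y *: idfun + 0); split.
- by apply: Pol_lin => //; exact: Pol0.
- by move=> v w; rewrite cop1 /= tens_dot addr0 -dotZl.
have gl := om_Pol_scalar om_state; rewrite (gl) ?(Pol_scalar0 gl) //.
  have [_ _ -> _] := co_in_hom Cu.
  by have [_ -> _] := om_state; rewrite mulr1 addr0.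
exact: Pol0.
Qed.

(** With b = R(S) a, expanding the inequality
0 <= <(S (x) 1) zeta_a - zeta_b, (S (x) 1) zeta_a - zeta_b> leaves
|b h|^2 <= <(S (x) 1) zeta_a, (S (x) 1) zeta_a>, because all the other terms are
equal to |b h|^2 up to sign; this is at most s^2 |a h|^2 since s^2 - S^* S >= 0. *)
Lemma om_convolved_bound S T (s : C) : Pol I S -> om_convolved om S T ->
  0 <= s -> (forall x, `|S x| <= s * `|x|) -> forall x, `|T x| <= s * `|x|.
Proof.
move=> PS cT s0 Ss.
have [PT _] := cT; have bT := Linf_bounded (Pol_Linf PT).
have linS := Linf_linear (Pol_Linf PS).
have [_ P1 _ PM _] := irr_star_subalgebra I.
apply: (dense_bound (Pol_dense I) bT s0) => _ [a Pa ->].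
have [za ua] := untwist_exists Pa.
have [zb ub] := untwist_exists (PM _ _ PT Pa).
have normE b zs : untwists I b zs ->
    \sum_(z <- zs) \sum_(w <- zs)
      dotp H (z.1 h0) (w.1 h0) * om_form om z.2 w.2 = `|b h0| ^+ 2.
  move=> ubs; rewrite dotp_norm.
  exact: esym (matrix_coef_twist om_state P1 om_convolved1 ubs ubs).
have crossE : \sum_(z <- za) \sum_(w <- zb)
      dotp H (S (z.1 h0)) (w.1 h0) * om_form om z.2 w.2 = `|T (a h0)| ^+ 2.
  by rewrite -(matrix_coef_twist om_state PS cT ua ub) dotp_norm.
have posL : pos_kernel (om_form om) :=
  pos_kernel_comp (co_in Cu) (state_kernel om_state).
pose L (p q : H * op H) := om_form om p.2 q.2.
have posL2 : pos_kernel L by exact: (pos_kernel_comp snd posL).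
pose ps := [seq (z.1 h0, z.2) | z <- za].
have SaSa : \sum_(z <- za) \sum_(w <- za)
      dotp H (S (z.1 h0)) (S (w.1 h0)) * om_form om z.2 w.2 <=
    s ^+ 2 * `|a h0| ^+ 2.
  rewrite -(normE _ _ ua) -subr_ge0.
  have := pos_kernel_sum ps
    (pos_kernel_comp fst (pos_kernel_bound linS s0 Ss)) posL2; congr (0 <= _).
  rewrite big_map mulr_sumr -sumrB; apply: eq_bigr => z _.
  rewrite big_map mulr_sumr -sumrB; apply: eq_bigr => w _.
  by rewrite /L /= mulrBl mulrA.
(* zs represents the tensor (S (x) 1) zeta_a - zeta_b. *)
pose zs := [seq (S (z.1 h0), z.2) | z <- za] ++
           [seq (- (w.1 h0), w.2) | w <- zb].
have := pos_kernel_sum zs (pos_kernel_comp fst (pos_kernel_dot H)) posL2.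
rewrite big_cat /= !big_map.
under eq_bigr => z _ do rewrite big_cat /= !big_map.
rewrite big_split /=.
under [X in _ + X]eq_bigr => z _ do rewrite big_cat /= !big_map.
rewrite big_split /=.
set AA := (X in X + _ + _); set AB := (X in _ + X + _).
set BA := (X in _ + (X + _)); set BB := (X in _ + (_ + X)).
have -> : AB = - `|T (a h0)| ^+ 2.
  rewrite -crossE /AB -sumrN; apply: eq_bigr => z _; rewrite -sumrN.
  apply: eq_bigr => w _; rewrite -mulNr; congr (_ * _).
  by rewrite -[- w.1 h0]sub0r dotBr dot0r sub0r.
have -> : BA = - `|T (a h0)| ^+ 2.
  rewrite -(geC0_conj (exprn_ge0 2 (normr_ge0 (T (a h0))))) -crossE rmorph_sum.
  rewrite /BA exchange_big /= -sumrN; apply: eq_bigr => z _.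
  rewrite rmorph_sum -sumrN; apply: eq_bigr => w _.
  rewrite rmorphM /= -posL.1 -dotC -mulNr; congr (_ * _).
  by rewrite -[- w.1 h0]sub0r dotBl dot0l sub0r.
have -> : BB = `|T (a h0)| ^+ 2.
  rewrite -[RHS](normE (T \o a) zb ub); apply: eq_bigr => z _.
  apply: eq_bigr => w _; congr (_ * _).
  rewrite -[- w.1 h0]sub0r -[- z.1 h0]sub0r dotBr dot0r dotBl dot0l.
  by rewrite !sub0r opprK.
rewrite addNr addr0 subr_ge0 => le1.
rewrite -ler_sqr ?nnegrE ?mulr_ge0 // exprMn.
exact: le_trans le1 SaSa.
Qed.
End Bound.

(** * Coamenability and factorization of the idempotent state *)

Lemma scalarB (R : realType) (V : lmodType R[i]) (f : V -> R[i]) :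
  scalar f -> {morph f : x y / x - y}.
Proof.
by move=> fs x y; apply: (lin_onB (W := R[i]^o) (P := setT)) => // *; exact: fs.
Qed.

Lemma co_in0 (R : realType) (G : compactQG R) (I : irrSystem G)
    (A : completion (Pol I)) : co_in A 0 = 0.
Proof.
have [inl _ _ _] := co_in_hom A; have := inl (-1) _ _ (Pol0 I) (Pol0 I).
by rewrite scaler0 addr0 scaleN1r addNr.
Qed.

Section Coamenability.
Variables (R : realType) (G : compactQG R) (I : irrSystem G).
Variables (Cu Cr : completion (Pol I)).
Hypothesis hCr : reduced_completion Cr.
Variables (Gam : Cu -> Cr) (eps om : Cu -> R[i]).
Hypotheses (hGam : canonical_surjection Gam) (heps : is_counit eps).
Hypothesis hom : idempotent_state om.
Local Notation C := R[i].
Local Notation h0 := (haar G).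
Let om_state : state_on [set: Cu] om := hom.1.

Lemma scalar_Pol_scalar (phi : Cu -> C) :
  scalar phi -> Pol_scalar I (phi \o co_in Cu).
Proof.
by move=> phil c S T PS PT /=; have [-> // _ _ _] := co_in_hom Cu; rewrite phil.
Qed.

Lemma eps_scalar : scalar eps.
Proof. by case: heps => [[]]. Qed.

Let oml : Pol_scalar I (om \o co_in Cu) := om_Pol_scalar om_state.

(** Both sides are om(u_ij) at S = u_ij, because eps(u_it) = delta_it. *)
Lemma eps_conv S T : Pol I S -> om_convolved om S T ->
  eps (co_in Cu T) = om (co_in Cu S).
Proof.
have epsl := scalar_Pol_scalar eps_scalar.
apply: (om_convolved_functional om_state epsl oml) => p i j.
rewrite (Pol_scalar_sum _ epsl); last by move=> t _; exact: Pol_u.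
rewrite /= (bigD1 i) //= heps.2 eqxx mulr1 big1 ?addr0 // => t /negPf ti.
by rewrite heps.2 eq_sym ti mulr0.
Qed.

(** At S = u_ij this is om * om = om. *)
Lemma om_conv S T : Pol I S -> om_convolved om S T ->
  om (co_in Cu T) = om (co_in Cu S).
Proof.
apply: (om_convolved_functional om_state oml oml) => p i j.
rewrite (Pol_scalar_sum _ oml); last by move=> t _; exact: Pol_u.
by rewrite hom.2; apply: eq_bigr => t _; exact: mulrC.
Qed.

Lemma eps_om_CuE x : CuE om x -> eps x = om x.
Proof.
have [c c0 omc] : exists2 c : C, 0 <= c &
    forall x, [set: Cu] x -> `|om x| <= c * `|x|.
  by case: om_state => /dual_bound.
move=> Ex; apply/eqP; rewrite -subr_eq0; apply/eqP.
have oms := state_scalar om_state; have epss := eps_scalar.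
apply: (functional_vanish (d := fun x => eps x - om x) (c := 1 + c) _ _ _ Ex).
- by move=> y z; rewrite (scalarB oms) (scalarB epss) !opprD addrACA.
- move=> y; apply: le_trans (ler_normB _ _) _; rewrite mulrDl mul1r.
  by rewrite lerD ?omc //; case: heps => -[].
move=> _ [T [S [PS RT]] <-]; have [T' cT'] := om_convolved_exists om_state PS.
rewrite (R_graph_unique om_state PS cT' RT).
by rewrite (eps_conv PS cT') (om_conv PS cT') subrr.
Qed.

Lemma Mr_coamenable : Mr Gam om -> coamenable Gam eps om.
Proof.
move=> [mu [mud muE]]; exists mu; split; last first.
  by move=> x Ex; rewrite -muE eps_om_CuE.
have [[Gl GM G1 Gs _] Gi] := hGam.
have [mul _] := mud; have [c c0 muc] := dual_bound mud.
have mus : scalar mu by move=> a x y; exact: mul.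
split.
- by split=> [a x y _ _|]; [exact: mus|exists c => x _; exact: muc].
- by rewrite -G1 -muE; case: om_state.
move=> x _; apply: ge0_approx => e e0.
(* If |x - y| <= m <= 1 with y in Pol, then
   |x^* x - y^* y| <= (2 |x| + 1) m. *)
have k0 : 0 < c * (`|x| + `|x| + 1) + 1.
  by rewrite ltr_wpDl // mulr_ge0 ?addr_ge0.
have [m [m0 m1 me]] :=
  common_lower_bound (ltr01 : 0 < 1 :> C) (divr_gt0 e0 k0).
have [|_ [T PT <-] xT] := @closure_approx _ _ (co_in Cr @` Pol I) x _ m m0.
  by rewrite co_dense.
exists (mu (cmul (cstar (co_in Cr T)) (co_in Cr T))).
  rewrite -Gi // -Gs -GM -muE; case: om_state => _ _; exact.
set y := co_in Cr T in xT *.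
rewrite -(scalarB mus); apply: le_trans (muc _ Logic.I) _.
have -> : cmul (cstar x) x - cmul (cstar y) y =
   cmul (cstar x) (x - y) + cmul (cstar (x - y)) y.
  have Bl a b z : cmul (a - b) z = cmul a z - cmul b z :> Cr.
    by rewrite [a - b]addrC -[- b]scaleN1r cmul_linearl scaleN1r addrC.
  have Br a b z : cmul z (a - b) = cmul z a - cmul z b :> Cr.
    by rewrite [a - b]addrC -[- b]scaleN1r cmul_linearr scaleN1r addrC.
  have sB a b : cstar (a - b) = cstar a - cstar b :> Cr.
    rewrite [a - b]addrC -[- b]scaleN1r cstar_linear.
    by rewrite rmorphN rmorph1 scaleN1r addrC.
  by rewrite Br sB Bl addrA subrK.
have ye : `|y| <= `|x| + 1.
  have -> : y = x - (x - y) by rewrite opprB addrC subrK.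
  by apply: le_trans (ler_normB _ _) _; rewrite lerD2l (le_trans (ltW xT)).
have : `|cmul (cstar x) (x - y) + cmul (cstar (x - y)) y| <=
     (`|x| + `|x| + 1) * m.
  apply: le_trans (ler_normD _ _) _; rewrite -addrA mulrDl lerD //.
    apply: le_trans (cmul_norm _ _) _; rewrite cstar_isometry.
    by rewrite ler_wpM2l // ltW.
  apply: le_trans (cmul_norm _ _) _; rewrite cstar_isometry mulrC.
  by rewrite ler_pM // ltW.
move/(ler_wpM2l c0)/le_trans; apply; rewrite mulrA.
apply: le_trans (_ : (c * (`|x| + `|x| + 1) + 1) * m <= e).
  by rewrite ler_wpM2r ?lerDl // ltW.
by rewrite mulrC -ler_pdivlMr.
Qed.

Lemma coamenable_Mr : coamenable Gam eps om -> Mr Gam om.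
Proof.
move=> [epsN [[/dual_bound [c c_ge0 epsc] _ _] epsNE]].
have [[Gl GM G1 Gs Gn] Gi] := hGam.
have [inl _ in1 _] := co_in_hom Cr.
have bound S : Pol I S -> `|om (co_in Cu S)| <= c * `|co_in Cr S|.
  move=> PS; have [T cT] := om_convolved_exists om_state PS.
  have ET : CuE om (co_in Cu T).
    apply: subset_closure; exists T => //; exists S; split=> //.
    exact: R_graph_convolved.
  rewrite -(eps_conv PS cT) -(epsNE _ ET).
  apply: le_trans (epsc _ _) _; first by exists (co_in Cu T).
  rewrite ler_wpM2l // Gi; last exact: cT.1.
  have [_ -> //] := hCr (cT.1).
  by apply: (om_convolved_bound om_state PS cT) => //; exact: (hCr PS).1.
(* The extension takes values in the line of haar, so that the completeness of L^2
   stands in for that of the scalars. *)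
have [||||||L [linL LE]] := @extend_bounded C (op (L2 G)) Cr (L2 G) (Pol I)
  (co_in Cr) (fun S => om (co_in Cu S) *: h0) c.
- move=> a x y; exact: Pol_lin.
- by move=> a x y; exact: inl.
- by move=> a x y Px Py; rewrite /= (om_Pol_scalar om_state) // scalerDl scalerA.
- by [].
- by move=> S PS; rewrite normrZ haar_norm mulr1 bound.
- exact: co_dense.
pose mu x := dotp (L2 G) (L x) h0.
have hh : dotp (L2 G) h0 h0 = 1 by rewrite -dotp_norm haar_norm expr1n.
have Lc x : `|L x| <= c * `|x|.
  have := LE x 0 (Pol0 I).
  by rewrite !co_in0 (lin0 (W := C^o) (state_scalar om_state)) scale0r !subr0.
have mus : scalar mu by move=> a x y; rewrite /mu linL dotDl dotZl.
have muc x : `|mu x| <= c * `|x|.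
  by apply: le_trans (cauchy_schwarz _ _) _; rewrite haar_norm mulr1.
exists mu; split; first by split=> [a x y _ _|]; [exact: mus|exists c].
have [d d0 omd] : exists2 d : C, 0 <= d &
    forall x, [set: Cu] x -> `|om x| <= d * `|x|.
  by case: om_state => /dual_bound.
move=> x; apply/eqP; rewrite -subr_eq0; apply/eqP.
apply: (@functional_vanish _ _ (fun x => om x - mu (Gam x)) (d + c)
   (co_in Cu @` Pol I)).
- move=> y z; have GB : Gam (y - z) = Gam y - Gam z.
    by apply: (lin_onB (P := setT)) => // *; exact: Gl.
  by rewrite (scalarB (state_scalar om_state)) GB (scalarB mus) !opprD addrACA.
- move=> y; apply: le_trans (ler_normB _ _) _; rewrite mulrDl lerD ?omd //.
  by apply: le_trans (muc _) _; rewrite ler_wpM2l.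
- move=> _ [S PS <-]; rewrite Gi //; apply/eqP; rewrite subr_eq0; apply/eqP.
  have /normr0_eq0/eqP : `|L (co_in Cr S) - om (co_in Cu S) *: h0| = 0.
    apply/eqP; rewrite eq_le normr_ge0 andbT; apply: le_trans (LE _ _ PS) _.
    by rewrite subrr normr0 mulr0.
  by rewrite subr_eq0 /mu => /eqP ->; rewrite dotZl hh mulr1.
by rewrite co_dense.
Qed.
End Coamenability.

Theorem theorem4p10 (R : realType) (G : compactQG R) (I : irrSystem G)
    (Cu Cr : completion (Pol I))
    (hCu : universal_completion Cu) (hCr : reduced_completion Cr)
    (Gam : Cu -> Cr) (hGam : canonical_surjection Gam)
    (eps : Cu -> R[i]) (heps : is_counit eps)
    (om : Cu -> R[i]) (hom : idempotent_state om) :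
  coamenable Gam eps om <-> Mr Gam om.
Proof.
split; [exact: coamenable_Mr|exact: Mr_coamenable].
Qed.
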